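(* For any fixed $M\in\mathbb{N}$ we have, as $n\to\infty$, $$(\beta_n-1)\sim(\beta_{M,n}^*-1)\sim\frac{\log n}{n},$$ where $u_n\sim v_n$ means $u_n/v_n\to1$ as $n\to\infty$.
   Context: $\mathbb{N}=\{1,2,3,\ldots\}$. For $n\in\mathbb{N}$, $\beta_n$ denotes the unique zero of $f_n(x)=x^{n+1}-x^n-1$ in the interval $(1,2)$. For $M\in\mathbb{N}$, $\beta\in(1,M+1]$ and $x\in[0,\frac{M}{\beta-1}]$, let $\Sigma_{\beta,M}(x)=\{(a_i)_{i\ge1}\in\{0,\ldots,M\}^{\mathbb{N}}:\sum_{i=1}^{\infty}\frac{a_i}{\beta^i}=x\}$. For $(a_i)\in\{0,\ldots,M\}^{\mathbb{N}}$ and $k\in\{0,\ldots,M\}$, $\mathrm{freq}_k(a_i)=\lim_{N\to\infty}\frac{\#\{1\le i\le N:a_i=k\}}{N}$, when the limit exists. $\Delta_M=\{(p_k)_{k=0}^M\in\mathbb{R}^{M+1}:p_k\ge0,\ \sum_{k=0}^M p_k=1\}$; for $\epsilon>0$, $\Delta_{M,\epsilon}=\{(p_k)_{k=0}^M\in\mathbb{R}^{M+1}:0\le p_k\le 1-\epsilon,\ \sum_{k=0}^M p_k=1\}$; and $\Delta_{M,\beta}(x)$ is the set of $(p_k)\in\Delta_M$ for which there exists $(a_i)\in\Sigma_{\beta,M}(x)$ such that $\mathrm{freq}_k(a_i)$ exists and equals $p_k$ for all $0\le k\le M$. For $M,n\in\mathbb{N}$, $$\beta_{M,n}^*=\sup\Big\{\beta^*:\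 \forall\beta\in(1,\beta^* )\text{ we have }\Delta_{M,\frac1{n+1}}\subseteq\Delta_{M,\beta}(x)\ \ \forall x\in\Big(0,\frac{M}{\beta-1}\Big)\Big\},$$ where $\beta^*$ ranges over $(1,M+1]$ (the range of bases for which $\Delta_{M,\beta}(x)$ is defined). *)

(* Defs.v *)
From mathcomp Require Import all_boot all_order all_algebra.
From mathcomp Require Import all_classical all_reals all_analysis.
From mathcomp Require Import lra.
Set Implicit Arguments.
Unset Strict Implicit.
Unset Printing Implicit Defensive.
Import Order.TTheory GRing.Theory Num.Theory.
Import numFieldNormedType.Exports.
Local Open Scope classical_set_scope.
Local Open Scope ring_scope.

Definition beta_fun (R : realType) (n : nat) (x : R) : R := x ^+ n.+1 - x ^+ n - 1.

Definition beta_zero (R : realType) (n : nat) : set R :=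
  [set x : R | 1 < x < 2 /\ beta_fun n x = 0].

(* For n >= 1 the set is a singleton (exists_unique_beta_zero below). *)
Definition beta (R : realType) (n : nat) : R := xget 0 (beta_zero n).

Lemma exists_unique_beta_zero (R : realType) (n : nat) :
  (0 < n)%N -> exists! x : R, beta_zero n x.
Proof.
move=> n0.
have fE (x : R) : beta_fun n x = x ^+ n * (x - 1) - 1.
  by rewrite /beta_fun exprSr mulrBr mulr1.
have uniq_lt (x y : R) : beta_zero n x -> beta_zero n y -> ~ x < y.
  move=> [/andP[x1 _] fx] [/andP[y1 _] fy] xy.
  have hxn : x ^+ n <= y ^+ n by apply: lerXn2r; rewrite ?nnegrE; lra.
  have x0 : 0 < x ^+ n by apply: exprn_gt0; lra.
  move: fx fy; rewrite !fE => fx fy.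
  have h1 : x ^+ n * (x - 1) < x ^+ n * (y - 1) by rewrite ltr_pM2l //; lra.
  have h2 : x ^+ n * (y - 1) <= y ^+ n * (y - 1) by rewrite ler_pM2r //; lra.
  lra.
pose q : {poly R} := 'X^(n.+1) - 'X^n - 1.
have [x xI /rootP fx] : exists2 x : R, x \in `[1, 2] & root q x.
  case: (@poly_ivt R q 1 2).
  - lra.
  - rewrite /q !hornerE !expr1n exprS.
    have : 1 <= (2 : R) ^+ n by apply: exprn_ege1; lra.
    move=> h; apply/andP; split; lra.
  - by move=> x xI rx; exists x.
have {}fx : beta_fun n x = 0 by move: fx; rewrite /beta_fun /q !hornerE.
have hx : beta_zero n x.
  split=> //; move: xI; rewrite in_itv /= => /andP[]; rewrite !le_eqVlt.
  have h2 : 2 <= (2 : R) ^+ n.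
    by rewrite -[leLHS]expr1; apply: ler_weXn2l => //; lra.
  case/orP=> [/eqP x1|->]; first by move: fx; rewrite fE -x1; lra.
  case/orP=> [/eqP x2|->] //; move: fx; rewrite fE x2; lra.
exists x; split=> // y hy.
by case: (ltgtP x y) => // xy; [case: (uniq_lt x y)|case: (uniq_lt y x)].
Qed.

(* A sequence (a_i)_(i >= 1) is shifted to start at index 0: [a i] is the
   digit of [b ^- i.+1]. *)
Definition Sigma (R : realType) (M : nat) (b x : R) : set (nat -> 'I_M.+1) :=
  [set a : nat -> 'I_M.+1 |
    series (fun i => (a i : nat)%:R / b ^+ i.+1) @ \oo --> x].

Definition has_freq (R : realType) (M : nat) (a : nat -> 'I_M.+1)
    (k : 'I_M.+1) (p : R) : Prop :=
  (#|[pred i : 'I_N | a i == k]|%:R / N%:R : R) @[N --> \oo] --> p.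

Definition Delta (R : realType) (M : nat) : set ('I_M.+1 -> R) :=
  [set p | (forall k, 0 <= p k) /\ \sum_k p k = 1].

Definition Delta_eps (R : realType) (M : nat) (eps : R) :
    set ('I_M.+1 -> R) :=
  [set p | (forall k, 0 <= p k <= 1 - eps) /\ \sum_k p k = 1].

Definition Delta_beta (R : realType) (M : nat) (b x : R) :
    set ('I_M.+1 -> R) :=
  [set p | Delta p /\
    exists2 a : nat -> 'I_M.+1, Sigma b x a & forall k, has_freq a k (p k)].

Definition beta_star (R : realType) (M n : nat) : R :=
  sup [set bs : R | 1 < bs <= M.+1%:R /\
    forall b, 1 < b < bs ->
    forall x, 0 < x < M%:R / (b - 1) ->
      @Delta_eps R M n.+1%:R^-1 `<=` Delta_beta b x].

Definition asymp_equiv (R : realType) (u v : nat -> R) : Prop :=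
  u n / v n @[n --> \oo] --> (1 : R).

(* Main.v *)
Require Import Defs.
From mathcomp Require Import all_boot all_order all_algebra.
From mathcomp Require Import all_classical all_reals all_analysis.
From mathcomp Require Import ring lra zify.
Import Order.TTheory GRing.Theory Num.Theory.
Import numFieldNormedType.Exports.
Local Open Scope classical_set_scope.
Local Open Scope ring_scope.

(** Both bases lie, for large [n], between two explicit sequences whose
distances to [1] are asymptotic to [ln n / n]: with [t = ln n], they are
[1 + (t - ln (2 t)) / n] and [(1 + M / n) / (1 - t / n)]. For beta_n this holds
because [x ^+ n * (x - 1)] increases with [x] and takes the value [1] at beta_n.

The upper bound on beta^* is an entropy estimate. A word of length [N] at most
[N / n] of whose digits are nonzero is one of at most
[(expR (t / n) * (1 + M / n)) ^+ N] words ([card_sparse]), and the first [N]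
digits of an expansion in base [b] locate the point up to
[M / (b - 1) / b ^+ N]. When [b] exceeds this growth rate, the lemma of Borel
and Cantelli shows that almost no point has an expansion in which the digit [0]
has frequency [1 - 1 / (n + 1)] ([exists_not_Delta_beta]).

For the lower bound, suppose [b ^+ n * (b - 1) <= 1 / 2] and
[4 * M * (b - 1) <= 1]; then every interior point has expansions with every
frequency vector whose entries are at most [1 - 1 / (n + 1)]
([Delta_eps_sub_Delta_beta]). Choosing the digit [a] moves the current point
[y] to [b * y - a], and a sequence of choices spells an expansion of the
starting point as soon as the orbit returns infinitely often to a bounded set
of nonnegative numbers. For two digits [j] and [k] there is an affine coordinate
[z] in which [j] acts as [z |-> b * z] and [k] as [z |-> b * z - 1]. A block made
of one letter [k] and [n] letters [j], with [k] followed by [m] of them, acts as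
[z |-> b ^+ n.+1 * z - b ^+ m]; since consecutive powers [b ^+ m] are close, some
[m] keeps [z] in a fixed interval ([exists_block]). Hence the frequency
[n / (n + 1)] for [j] and [1 / (n + 1)] for [k] can be sustained for any length
of time. Passing from one pair of digits to another costs a bounded number of
digits ([exists_transit]). Finally every admissible frequency vector is a convex
combination of these two-digit ones ([Delta_eps_pairs]): stages of linearly
growing length that use the pairs in the right proportions, up to a bounded
error, have the required frequencies in the limit ([has_freq_concat]). *)

Set Implicit Arguments.
Unset Strict Implicit.
Unset Printing Implicit Defensive.

(** * Concatenation of finite words *)

Section Concatenation.
Context {T : eqType} (t0 : T).
Implicit Types (U : nat -> seq T).

Definition concat_prefix U (r : nat) : seq T := flatten (map U (iota 0 r)).

(** Position [i] is covered by the first [i + 1] words when every word is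
nonempty, so the default value is never read. *)
Definition concat U (i : nat) : T := nth t0 (concat_prefix U i.+1) i.

Lemma concat_prefixS U r :
  concat_prefix U r.+1 = concat_prefix U r ++ U r.
Proof.
by rewrite /concat_prefix -addn1 iotaD map_cat flatten_cat /= cats0.
Qed.

Lemma leq_size_concat_prefix U r r' : (r <= r')%N ->
  (size (concat_prefix U r) <= size (concat_prefix U r'))%N.
Proof.
move=> /subnKC <-.
by rewrite /concat_prefix iotaD map_cat flatten_cat size_cat leq_addr.
Qed.

Lemma nth_concat_prefixW U r r' i : (r <= r')%N ->
  (i < size (concat_prefix U r))%N ->
  nth t0 (concat_prefix U r') i = nth t0 (concat_prefix U r) i.
Proof.
elim: r' => [|r' IH]; first by rewrite leqn0 => /eqP ->.
rewrite leq_eqVlt => /orP[/eqP -> //|rr' ir].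
rewrite concat_prefixS nth_cat -IH //.
case: ifPn => // /negP[].
exact: leq_trans ir (leq_size_concat_prefix _ _).
Qed.

Lemma size_concat_prefix U r : (forall r, r < size (U r))%N ->
  (r * r.+1 <= 2 * size (concat_prefix U r))%N.
Proof.
move=> hU; elim: r => [//|r IH]; rewrite concat_prefixS size_cat.
by have := hU r; nia.
Qed.

Lemma size_concat_prefix_ge U r : (forall r, r < size (U r))%N ->
  (r <= size (concat_prefix U r))%N.
Proof.
by move=> /(@size_concat_prefix _ r); case: r => // r; nia.
Qed.

Lemma mkseq_concat U r N : (forall r, r < size (U r))%N ->
  (N <= size (concat_prefix U r))%N ->
  mkseq (concat U) N = take N (concat_prefix U r).
Proof.
move=> hU Nr; apply: (@eq_from_nth _ t0); rewrite size_mkseq ?size_takel //.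
move=> i iN; rewrite nth_mkseq // nth_take // /concat.
have hi := @size_concat_prefix_ge _ i.+1 hU.
by case: (leqP i.+1 r) => ir; [symmetry|]; apply: nth_concat_prefixW; lia.
Qed.

Lemma concat_prefix_bracket U N : (forall r, r < size (U r))%N ->
  exists r, (size (concat_prefix U r) <= N < size (concat_prefix U r.+1))%N.
Proof.
move=> hU; pose P r := (N < size (concat_prefix U r.+1))%N.
have exP : exists r, P r by exists N; exact: size_concat_prefix_ge.
case: (ex_minnP exP) => -[|r] Pr minr; [by exists 0%N|exists r.+1].
by rewrite [X in _ && X]Pr andbT leqNgt; apply/negP => /minr; rewrite ltnn.
Qed.

End Concatenation.

Lemma card_eq_count_mkseq M (a : nat -> 'I_M.+1) k N :
  #|[pred i : 'I_N | a i == k]| = count_mem k (mkseq a N).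
Proof.
rewrite /mkseq -val_enum_ord -map_comp count_map cardE -size_filter.
congr size; rewrite {1}/enum_mem -enumT.
by apply: eq_filter => i; rewrite inE.
Qed.

Section Frequencies.
Context {R : realType} {M : nat}.
Implicit Types (p : 'I_M.+1 -> R) (U : nat -> seq 'I_M.+1).

Definition discrepancy p k (s : seq 'I_M.+1) : R :=
  (count_mem k s)%:R - p k * (size s)%:R.

Lemma discrepancy_cat p k s s' :
  discrepancy p k (s ++ s') = discrepancy p k s + discrepancy p k s'.
Proof. by rewrite /discrepancy count_cat size_cat !natrD; lra. Qed.

Lemma discrepancy_le_size p k s : 0 <= p k <= 1 ->
  `|discrepancy p k s| <= (size s)%:R.
Proof.
move=> /andP[p0 p1]; rewrite ler_norml.
have : (count_mem k s)%:R <= (size s)%:R :> R by rewrite ler_nat count_size.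
have : 0 <= (count_mem k s)%:R :> R by [].
have : 0 <= (size s)%:R :> R by [].
rewrite /discrepancy => *; apply/andP; split; nra.
Qed.

(** The discrepancy after [r] words is at most linear in [r], and so is the
length of the word being read, whereas the position grows quadratically in [r].
*)
Lemma has_freq_concat p (C : R) U :
    (forall k, 0 <= p k <= 1) ->
    (forall r, r < size (U r))%N ->
    (forall r, (size (U r))%:R <= C * r.+1%:R) ->
    (forall r k, `|discrepancy p k (U r)| <= C) ->
  forall k, has_freq (concat ord0 U) k (p k).
Proof.
move=> p01 U_gt U_le U_disc k.
have C0 : 0 <= C by exact: le_trans (normr_ge0 _) (U_disc 0%N k).
have prefix_disc r : `|discrepancy p k (concat_prefix U r)| <= C * r%:R.
  elim: r => [|r IH].
    by rewrite /discrepancy /= !mulr0 subr0 normr0.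
  rewrite concat_prefixS discrepancy_cat (le_trans (ler_normD _ _)) //.
  by rewrite -natr1 mulrDr mulr1 lerD.
apply/cvgrPdist_le => e e0.
(* The error is at most [2 * C * r.+1] at a position at least [r * r.+1 / 2]. *)
pose r0 := (Num.truncn (4 * C / e)).+1.
exists (size (concat_prefix U r0)).+1 => // N /= hN.
have [r /andP[rN Nr]] := concat_prefix_bracket N U_gt.
have r0r : (r0 <= r)%N.
  rewrite leqNgt; apply/negP => /(leq_size_concat_prefix U) hr.
  by have := leq_trans (leq_trans Nr hr) (ltnW hN); rewrite ltnn.
have Ce : 4 * C <= e * r%:R.
  rewrite [leRHS]mulrC -ler_pdivrMr //.
  apply: le_trans (ltW (truncnS_gt _)) _.
  by rewrite ler_nat.
have N0 : 0 < N%:R :> R by rewrite ltr0n; lia.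
rewrite card_eq_count_mkseq.
have disc : `|discrepancy p k (mkseq (concat ord0 U) N)| <= 2 * C * r.+1%:R.
  rewrite (mkseq_concat ord0 U_gt (ltnW Nr)) concat_prefixS take_cat.
  rewrite ltnNge rN /= discrepancy_cat (le_trans (ler_normD _ _)) //.
  have := prefix_disc r; have := U_le r.
  have := discrepancy_le_size (take (N - size (concat_prefix U r)) (U r)) (p01 k).
  have : (size (take (N - size (concat_prefix U r)) (U r)))%:R
      <= (size (U r))%:R :> R.
    by rewrite ler_nat size_take_min geq_minr.
  have : C * r%:R <= C * r.+1%:R by rewrite ler_wpM2l // ler_nat.
  by move=> *; lra.
have rN2 : r%:R * r.+1%:R <= 2 * N%:R :> R.
  rewrite -!natrM ler_nat (leq_trans (size_concat_prefix r U_gt)) //.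
  by rewrite leq_mul2l rN orbT.
have -> : p k - (count_mem k (mkseq (concat ord0 U) N))%:R / N%:R =
    - (discrepancy p k (mkseq (concat ord0 U) N) / N%:R).
  by rewrite /discrepancy size_mkseq; field; rewrite gt_eqF.
rewrite normrN normrM normfV (ger0_norm (ltW N0)) ler_pdivrMr //.
apply: le_trans disc _.
have : 0 <= r.+1%:R :> R by [].
by move=> *; nra.
Qed.

End Frequencies.

Section Orbits.
Context {R : realType} {M : nat}.
Implicit Types (b y : R) (s : seq 'I_M.+1).

(** The point left to expand after the digits [s] of [y] have been chosen: its
expansions are the continuations of [s]. *)
Definition orb b y s : R := foldl (fun y (a : 'I_M.+1) => b * y - (a : nat)%:R) y s.

Lemma orb_cat b y s s' : orb b y (s ++ s') = orb b (orb b y s) s'.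
Proof. exact: foldl_cat. Qed.

Lemma orb_mkseq b x (a : nat -> 'I_M.+1) N : 1 < b ->
  orb b x (mkseq a N) =
    b ^+ N * (x - series (fun i => (a i : nat)%:R / b ^+ i.+1) N).
Proof.
move=> b1; elim: N => [|N IH]; first by rewrite /series /= big_geq // subr0 mul1r.
rewrite mkseqS -cats1 orb_cat IH /= seriesSr /=.
have b0 : b != 0 by apply/eqP => b0; move: b1; rewrite b0; lra.
have bN : b ^+ N != 0 by rewrite expf_neq0.
by rewrite exprS; field; rewrite b0 bN.
Qed.

Lemma exists_expr_ge b C : 1 < b -> exists T, C <= b ^+ T.
Proof.
move=> b1.
have [T CT] : exists T, C <= T%:R * (b - 1).
  exists (Num.truncn (C / (b - 1))).+1.
  by rewrite -ler_pdivrMr ?subr_gt0 // ltW // truncnS_gt.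
exists T; apply: le_trans CT _.
suff : 1 + T%:R * (b - 1) <= b ^+ T by apply: le_trans; rewrite lerDr.
elim: T => [|T IH]; first by rewrite mul0r addr0.
have T0 : 0 <= T%:R :> R by [].
have b10 : 0 <= (b - 1) ^+ 2 by exact: sqr_ge0.
have : b * (1 + T%:R * (b - 1)) <= b * b ^+ T by rewrite ler_pM2l //; lra.
rewrite exprS -natr1; apply: le_trans.
rewrite -subr_ge0.
suff -> : b * (1 + T%:R * (b - 1)) - (1 + (T%:R + 1) * (b - 1)) =
    T%:R * (b - 1) ^+ 2.
  exact: mulr_ge0.
ring.
Qed.

(** The partial sums increase, so it is enough to control them at the ends of
the words, where they miss [x] by [orb b x _ / b ^+ N]. *)
Lemma Sigma_concat b x (B : R) (U : nat -> seq 'I_M.+1) :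
    1 < b -> (forall r, r < size (U r))%N ->
    (forall r, 0 <= orb b x (concat_prefix U r) <= B) ->
  Sigma b x (concat ord0 U).
Proof.
move=> b1 U_gt orbB; rewrite /Sigma /=; set u := (X in series X).
have b0 : 0 < b by lra.
have u0 i : 0 <= u i by rewrite /u divr_ge0 // exprn_ge0 // ltW.
have u_mono i j : (i <= j)%N -> series u i <= series u j.
  by move=> ij; rewrite -subr_ge0 sub_series_geq // sumr_ge0.
have u_prefix r (N := size (concat_prefix U r)) :
    x - B / b ^+ r <= series u N <= x.
  have bN : 0 < b ^+ N by rewrite exprn_gt0.
  have br : 0 < b ^+ r by rewrite exprn_gt0.
  have brN : b ^+ r <= b ^+ N.
    by apply: ler_weXn2l; [exact: ltW|exact: size_concat_prefix_ge].
  have := orbB r.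
  have -> : concat_prefix U r = mkseq (concat ord0 U) N.
    by rewrite (@mkseq_concat _ _ _ r) // take_size.
  rewrite orb_mkseq // -/u => /andP[h0 hB].
  rewrite pmulr_rge0 // subr_ge0 in h0; rewrite h0 andbT.
  rewrite lerBlDr -lerBlDl ler_pdivlMr // mulrC (le_trans _ hB) //.
  by rewrite ler_wpM2r // subr_ge0.
apply/cvgrPdist_le => e e0.
have [T BT] := exists_expr_ge (B / e) b1.
exists (size (concat_prefix U T)) => // N /= hN.
have /andP[h1 _] := u_prefix T.
have /andP[_ h2] := u_prefix N.
have h3 := u_mono _ _ hN.
have h4 := u_mono _ _ (size_concat_prefix_ge N U_gt).
have h5 : B / b ^+ T <= e.
  by rewrite ler_pdivrMr ?exprn_gt0 // mulrC -ler_pdivrMr.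
rewrite ger0_norm; lra.
Qed.
End Orbits.

(** * Dynamics of two digits *)

Section TwoDigits.
Context {R : realType} {M : nat}.
Implicit Types (b x y z e : R) (n m : nat) (i j k : 'I_M.+1) (s : seq 'I_M.+1).

(** The points expanded with the digit [j] only and with the digit [k] only
have the coordinates [z = 0] and [z = (b - 1)^-1]. *)
Definition between b j k z : R :=
  (j : nat)%:R / (b - 1) + ((k : nat)%:R - (j : nat)%:R) * z.

Lemma between_sym b j k z : between b j k z = between b k j ((b - 1)^-1 - z).
Proof. by rewrite /between; ring. Qed.

Lemma orb_between_left b j k z m : 1 < b ->
  orb b (between b j k z) (nseq m j) = between b j k (b ^+ m * z).
Proof.
move=> b1; have b10 : b - 1 != 0 by rewrite subr_eq0 gt_eqF.
elim: m z => [|m IH] z; first by rewrite mul1r.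
rewrite /= -/(orb _ _ _).
have -> : b * between b j k z - (j : nat)%:R = between b j k (b * z).
  by rewrite /between; field.
by rewrite IH exprSr mulrA.
Qed.

Lemma orb_between_right b j k z : 1 < b ->
  orb b (between b j k z) [:: k] = between b j k (b * z - 1).
Proof.
move=> b1; have b10 : b - 1 != 0 by rewrite subr_eq0 gt_eqF.
by rewrite /= /between; field.
Qed.

Definition block n m j k : seq 'I_M.+1 := nseq (n - m) j ++ k :: nseq m j.

Lemma orb_block b n m j k z : 1 < b -> (m <= n)%N ->
  orb b (between b j k z) (block n m j k) =
  between b j k (b ^+ n.+1 * z - b ^+ m).
Proof.
move=> b1 mn; rewrite /block -cat1s !orb_cat orb_between_left //.
rewrite orb_between_right // orb_between_left //; congr between.
rewrite mulrBr mulr1 !mulrA -exprSr -exprD.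
by congr (b ^+ _ * z - _); lia.
Qed.

Lemma count_block n m j k i : (m <= n)%N ->
  count_mem i (block n m j k) = (n * (i == j) + (i == k))%N.
Proof.
move=> mn; rewrite /block count_cat /= !count_nseq /= (eq_sym j) (eq_sym k).
by case: eqP => _; lia.
Qed.

(** [block_lo] and [block_hi] are the fixed points of the maps [z |-> b ^+ n.+1
* z - b ^+ m] for [m = 0] and [m = n]. *)
Definition block_lo b n : R := (b ^+ n.+1 - 1)^-1.
Definition block_hi b n : R := b ^+ n / (b ^+ n.+1 - 1).

(** The images of the interval under the inverse maps cover it: the extreme
maps fix its endpoints, and consecutive images overlap because [b ^+ m * (b -
1) <= block_hi b n - block_lo b n]. *)
Lemma exists_block b n z : 1 < b -> (0 < n)%N -> b ^+ n * (b - 1) <= 2^-1 ->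
    block_lo b n <= z <= block_hi b n ->
  exists2 m, (m <= n)%N &
    block_lo b n <= b ^+ n.+1 * z - b ^+ m <= block_hi b n.
Proof.
move=> b1 n0 small /andP[zlo zhi].
set X := b ^+ n in small.
have X1 : b <= X by rewrite /X -{1}(expr1 b) ler_weXn2l // ltW.
have D0 : 0 < b ^+ n.+1 - 1 by rewrite subr_gt0 exprn_egt1.
have XD : b ^+ n.+1 = b * X by rewrite exprS.
have lo_fix : b ^+ n.+1 * block_lo b n - 1 = block_lo b n.
  by rewrite /block_lo; field; rewrite gt_eqF.
have hi_fix : b ^+ n.+1 * block_hi b n - X = block_hi b n.
  by rewrite /block_hi -/X; field; rewrite gt_eqF.
have gap m : (m < n)%N -> b ^+ m * (b - 1) <= block_hi b n - block_lo b n.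
  move=> mn; have -> : block_hi b n - block_lo b n = (X - 1) / (b ^+ n.+1 - 1).
    by rewrite /block_hi /block_lo -/X; field; rewrite gt_eqF.
  rewrite ler_pdivlMr // XD.
  have bm : b * b ^+ m <= X by rewrite -exprS; apply: ler_weXn2l => //; exact: ltW.
  have bX : 0 <= b * X - 1 by rewrite -XD ltW.
  have h1 : b * (b ^+ m * (b - 1)) <= 2^-1.
    by apply: le_trans small; rewrite mulrA ler_wpM2r //; lra.
  have h2 : b * (b ^+ m * (b - 1)) * (b * X - 1) <= 2^-1 * (b * X - 1).
    exact: ler_wpM2r.
  have h3 : b * b <= b * X by rewrite ler_pM2l //; lra.
  rewrite -(@ler_pM2l _ b) ?mulrA //; last lra.
  move: h2; rewrite !mulrA => /le_trans; apply.
  have : 0 <= (b - 1) ^+ 2 by exact: sqr_ge0.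
  nra.
have [m0|noblock] := pselect (exists2 m, (m <= n)%N &
    block_lo b n <= b ^+ n.+1 * z - b ^+ m <= block_hi b n) => //.
(* Otherwise the image stays above the interval for every [m], which is absurd
   for [m = n] as [block_hi] is a fixed point. *)
suff /(_ n (leqnn n)) : forall m, (m <= n)%N ->
    block_hi b n < b ^+ n.+1 * z - b ^+ m.
  rewrite -/X -hi_fix ltrD2r ltr_pM2l ?exprn_gt0 //; lra.
elim=> [|m IH] mn; rewrite ltNge; apply/negP => hle; apply: noblock.
  exists 0%N => //; rewrite hle andbT -lo_fix expr0 lerD2r ler_pM2l //.
  by rewrite exprn_gt0 //; lra.
exists m.+1 => //; rewrite hle andbT.
by have := IH (ltnW mn); have := gap m mn; rewrite (exprS b m) => *; lra.
Qed.

(** Multiplying by [b] cannot jump over an interval whose endpoints have ratio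
at least [b]. *)
Lemma expr_reach b d lo hi z T : 1 < b -> 0 < d -> b * lo <= hi ->
    lo <= b ^+ T * d -> d <= z <= hi ->
  exists2 m, (m <= T)%N & lo <= b ^+ m * z <= hi.
Proof.
move=> b1 d0 lohi hT /andP[dz zhi].
have exP : exists m, lo <= b ^+ m * z.
  exists T; apply: le_trans hT _; rewrite ler_pM2l //.
  by apply: exprn_gt0; lra.
have PT : lo <= b ^+ T * z.
  by apply: le_trans hT _; rewrite ler_pM2l //; apply: exprn_gt0; lra.
case: (ex_minnP exP) => m Pm minm; exists m; first exact: minm.
rewrite Pm /=; case: m Pm minm => [|m] Pm minm; first by rewrite mul1r.
have : ~~ (lo <= b ^+ m * z) by apply/negP => /minm; rewrite ltnn.
rewrite -ltNge => hm; apply: le_trans lohi; rewrite exprS -mulrA.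
by rewrite ler_pM2l; [exact: ltW|lra].
Qed.

(** From below the target one repeats the digit [j], from above the digit [k],
which plays the same role for the reflected coordinate [(b - 1)^-1 - z]. *)
Lemma between_reach b d lo hi T j k z : 1 < b -> 0 < d ->
    b * lo <= hi -> b * ((b - 1)^-1 - hi) <= (b - 1)^-1 - lo -> lo <= hi ->
    (b - 1)^-1 <= b ^+ T * d -> 0 <= lo -> hi <= (b - 1)^-1 ->
    d <= z <= (b - 1)^-1 - d ->
  exists s, (size s <= T)%N /\
    exists2 z', lo <= z' <= hi & orb b (between b j k z) s = between b j k z'.
Proof.
move=> b1 d0 h1 h2 h3 hT lo0 hiq /andP[dz zd].
have [zhi|zhi] := leP z hi.
  have [||m mT hm] := @expr_reach b d lo hi z T b1 d0 h1; rewrite ?dz //; first lra.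
  exists (nseq m j); rewrite size_nseq; split=> //.
  by exists (b ^+ m * z) => //; rewrite orb_between_left.
have [||m mT hm] := @expr_reach b d ((b - 1)^-1 - hi) ((b - 1)^-1 - lo)
  ((b - 1)^-1 - z) T b1 d0 h2; rewrite ?dz //; first lra.
  by apply/andP; split; lra.
exists (nseq m k); rewrite size_nseq; split=> //.
exists ((b - 1)^-1 - b ^+ m * ((b - 1)^-1 - z)).
  by move: hm => /andP[? ?]; apply/andP; split; lra.
by rewrite between_sym orb_between_left // between_sym.
Qed.

End TwoDigits.

(** * Steering the orbit *)

(** The orbit is kept away from the two points that have a single expansion, so
that all waiting times are bounded. *)
Definition core (R : realType) (M : nat) (b e : R) : set R :=
  [set y | e <= y <= M%:R / (b - 1) - e].

Section Steering.
Context {R : realType} {M : nat}.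
Implicit Types (b x y z e : R) (n m : nat) (i j k : 'I_M.+1) (s : seq 'I_M.+1).

(** The point is the combination of [j] and [k] with coefficients [(b - 1)^-1 -
z] and [z]; as [j] and [k] differ, one of them is at least [1] and one is at
most [M - 1]. *)
Lemma between_in_core b e lo hi j k z : 1 < b -> j != k ->
    e <= lo -> e <= (b - 1)^-1 - hi -> 0 <= e -> lo <= z <= hi ->
  core M b e (between b j k z).
Proof.
move=> b1 jk elo ehi e0 /andP[loz zhi]; rewrite /core /between /=.
set q := (b - 1)^-1 in ehi *.
have jM : (j : nat)%:R <= M%:R :> R by rewrite ler_nat -ltnS.
have kM : (k : nat)%:R <= M%:R :> R by rewrite ler_nat -ltnS.
have j0 : 0 <= (j : nat)%:R :> R by [].
have k0 : 0 <= (k : nat)%:R :> R by [].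
have one : 1 <= (j : nat)%:R + (k : nat)%:R :> R.
  by rewrite -natrD ler1n; move: jk; rewrite -(inj_eq val_inj) /=; lia.
have two : 1 <= (M%:R - (j : nat)%:R) + (M%:R - (k : nat)%:R) :> R.
  have jM' := ltn_ord j; have kM' := ltn_ord k.
  have : (j + k + 1 <= M + M)%N.
    by move: jk; rewrite -(inj_eq val_inj) /=; lia.
  by rewrite -(ler_nat R) !natrD; lra.
move: jM kM j0 k0 one two.
move: (j : nat)%:R (k : nat)%:R => J K jM kM j0 k0 one two.
have h1 : J * e <= J * (q - z) by rewrite ler_wpM2l //; lra.
have h2 : K * e <= K * z by rewrite ler_wpM2l //; lra.
have h3 : (M%:R - J) * e <= (M%:R - J) * (q - z) by rewrite ler_wpM2l //; lra.
have h4 : (M%:R - K) * e <= (M%:R - K) * z by rewrite ler_wpM2l //; lra.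
have h5 : 1 * e <= (J + K) * e by rewrite ler_wpM2r.
have h6 : 1 * e <= ((M%:R - J) + (M%:R - K)) * e by rewrite ler_wpM2r.
by apply/andP; split; lra.
Qed.

Lemma between_of_gap b j k y : j != k ->
    (minn j k)%:R / (b - 1) + M%:R <= y <= (maxn j k)%:R / (b - 1) - M%:R ->
  exists2 z, 1 <= z <= (b - 1)^-1 - 1 & y = between b j k z.
Proof.
have main (u v : 'I_M.+1) : (u < v)%N ->
    (u : nat)%:R / (b - 1) + M%:R <= y <= (v : nat)%:R / (b - 1) - M%:R ->
    exists2 z, 1 <= z <= (b - 1)^-1 - 1 & y = between b u v z.
  move=> uv /andP[h1 h2].
  have u0 : 0 <= (u : nat)%:R :> R by [].
  have vM : (v : nat)%:R <= M%:R :> R by rewrite ler_nat -ltnS.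
  have vu : 0 < (v : nat)%:R - (u : nat)%:R :> R by rewrite subr_gt0 ltr_nat.
  exists ((y - (u : nat)%:R / (b - 1)) / ((v : nat)%:R - (u : nat)%:R)).
    rewrite ler_pdivlMr // ler_pdivrMr // mul1r mulrBl mul1r mulrBr.
    rewrite ![(b - 1)^-1 * _]mulrC.
    by apply/andP; split; lra.
  by rewrite /between mulrCA divff ?mulr1 ?gt_eqF //; lra.
move=> jk; case: (ltngtP j k) => [jltk|kltj|/val_inj jeqk].
- exact: main.
- move=> /(main k j kltj)[z hz ->]; exists ((b - 1)^-1 - z).
    by move: hz => /andP[? ?]; apply/andP; split; lra.
  exact: between_sym.
- by move: jk; rewrite jeqk eqxx.
Qed.

Lemma block_range b n : 1 < b -> (0 < n)%N ->
  [/\ 0 < block_lo b n, block_lo b n < block_hi b n, block_hi b n < (b - 1)^-1,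
      b * block_lo b n <= block_hi b n &
      b * ((b - 1)^-1 - block_hi b n) <= (b - 1)^-1 - block_lo b n].
Proof.
move=> b1 n0; rewrite /block_lo /block_hi exprS.
set X := b ^+ n.
have X1 : b <= X by rewrite /X -{1}(expr1 b) ler_weXn2l // ltW.
have D0 : 0 < b * X - 1 by nra.
have b10 : 0 < b - 1 by lra.
split.
- by rewrite invr_gt0.
- by rewrite -{1}[(_ - 1)^-1]mul1r ltr_pM2r ?invr_gt0 //; lra.
- by rewrite ltr_pdivrMr // mulrC ltr_pdivlMr //; lra.
- by rewrite ler_pM2r ?invr_gt0 //.
- rewrite -subr_ge0 le_eqVlt; apply/orP; left; apply/eqP.
  by field; rewrite !gt_eqF.
Qed.

Lemma ltn_minn_maxn j k : j != k -> (minn j k < maxn j k)%N.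
Proof.
rewrite -(inj_eq val_inj) /= neq_ltn => /orP[] jk;
  by rewrite leq_max !gtn_min jk ?orbT.
Qed.

(** With the digits [0] and [M] one first moves into the gap between the fixed
points of [j] and [k], at distance at least [M] from both of them; no step is
longer than [M], and the gap is long enough not to be jumped over when [4 * M *
(b - 1) <= 1]. The digits [j] and [k] then lead to the target. The distance [M]
is what makes the second phase take a bounded time. *)
Lemma exists_transit b n e : 1 < b -> (0 < n)%N -> (0 < M)%N ->
    4 * M%:R * (b - 1) <= 1 -> 0 < e ->
  exists T, forall y j k, core M b e y -> j != k ->
    exists s, (size s <= T)%N /\
      exists2 z, block_lo b n <= z <= block_hi b n & orb b y s = between b j k z.
Proof.
move=> b1 n0 M0 hM e0; set q := (b - 1)^-1.
have b10 : 0 < b - 1 by lra.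
have M1 : 1 <= M%:R :> R by rewrite ler1n.
have q4 : 4 * M%:R <= q by rewrite /q -[leRHS]mul1r ler_pdivlMr.
have d0 : 0 < e / M%:R by rewrite divr_gt0 //; lra.
have [T1] := exists_expr_ge (q / (e / M%:R)) b1.
have [T2] := exists_expr_ge q b1.
rewrite ler_pdivrMr // => hT2 hT1.
have [lo0 lohi hiq blo bhi] := block_range b1 n0.
exists (T1 + T2)%N => y j k /andP[ey yqe] jk.
(* The gap with margins [M], in the coordinate of the digits [0] and [M]. *)
pose lo1 := (minn j k)%:R * q / M%:R + 1.
pose hi1 := (maxn j k)%:R * q / M%:R - 1.
have Mgt0 : 0 < M%:R :> R by rewrite ltr0n.
have [jM kM] : (j <= M)%N /\ (k <= M)%N by split; rewrite -ltnS.
have minM : (minn j k)%:R / M%:R <= 1 :> R.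
  by rewrite ler_pdivrMr // mul1r ler_nat geq_min jM.
have maxM : (maxn j k)%:R / M%:R <= 1 :> R.
  by rewrite ler_pdivrMr // mul1r ler_nat geq_max jM kM.
have min0 : 0 <= (minn j k)%:R / M%:R :> R by rewrite divr_ge0.
have minmax : (minn j k)%:R / M%:R + M%:R^-1 <= (maxn j k)%:R / M%:R :> R.
  rewrite -{2}[M%:R^-1]mul1r -mulrDl ler_wpM2r ?invr_ge0 // natr1 ler_nat.
  exact: ltn_minn_maxn.
have bq : (b - 1) * q = 1 by rewrite /q divff // gt_eqF.
have qM4 : 4 <= M%:R^-1 * q by rewrite mulrC ler_pdivlMr //; lra.
have b2 : b - 1 <= 1.
  apply: le_trans hM; rewrite -{1}[b - 1]mul1r ler_wpM2r ?ltW //; lra.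
have lo1E : lo1 = (minn j k)%:R / M%:R * q + 1 by rewrite /lo1 mulrAC.
have hi1E : hi1 = (maxn j k)%:R / M%:R * q - 1 by rewrite /hi1 mulrAC.
move: minM maxM min0 minmax lo1E hi1E.
set A := (minn j k)%:R / M%:R; set B := (maxn j k)%:R / M%:R.
move=> minM maxM min0 minmax lo1E hi1E.
have ABq : A * q + M%:R^-1 * q <= B * q.
  by rewrite -mulrDl ler_wpM2r // invr_ge0 ltW.
have q0 : 0 < q by rewrite invr_gt0.
have Bq : B * q <= q by rewrite -[leRHS]mul1r ler_wpM2r // ltW.
have bq' : b * q = q + 1 by rewrite -bq; ring.
have bAq : b * (A * q) = A * q + A by rewrite mulrCA bq'; ring.
have bBq : b * (B * q) = B * q + B by rewrite mulrCA bq'; ring.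
have B0 : 0 <= B by rewrite divr_ge0.
have b1le : b <= 2 by lra.
have [|||||||s1 [s1T [z1 /andP[lo1z z1hi] orb1]]] :=
  @between_reach R M b (e / M%:R) lo1 hi1 T1 ord0 ord_max (y / M%:R) b1 d0.
- by rewrite lo1E hi1E mulrDr bAq; lra.
- by rewrite lo1E hi1E -/q !mulrDr mulrN mulrDr bq' bBq; lra.
- by rewrite lo1E hi1E; lra.
- exact: hT1.
- by rewrite lo1E addr_ge0 // mulr_ge0 // ltW.
- by rewrite hi1E -/q; lra.
- rewrite ler_pM2r ?invr_gt0 ?ltr0n // ey /= -/q ler_pdivrMr ?ltr0n //.
  rewrite mulrBl divfK ?gt_eqF ?ltr0n //.
  by move: yqe; rewrite -/q; lra.
have [|z2 hz2 y2E] := @between_of_gap b j k (M%:R * z1) jk.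
  rewrite -/q; apply/andP; split.
    move: lo1z; rewrite -(ler_pM2l Mgt0) /lo1 mulrDr mulr1 mulrC divfK ?gt_eqF //.
  move: z1hi; rewrite -(ler_pM2l Mgt0) /hi1 mulrBr mulr1 [M%:R * (_ / _)]mulrC.
  by rewrite divfK ?gt_eqF.
have [||||s2 [s2T [z hz orb2]]] := @between_reach R M b 1 (block_lo b n)
  (block_hi b n) T2 j k z2 b1 ltr01 blo bhi _ _ _ _ hz2.
- exact: ltW.
- by rewrite mulr1.
- exact: ltW.
- exact: ltW.
exists (s1 ++ s2); rewrite size_cat leq_add //; split=> //.
exists z => //; rewrite orb_cat -orb2 -y2E; congr orb.
have zeroM x : between b (ord0 : 'I_M.+1) ord_max x = M%:R * x.
  by rewrite /between /= mul0r subr0 add0r.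
have yE : y = between b (ord0 : 'I_M.+1) ord_max (y / M%:R).
  by rewrite zeroM mulrC divfK // gt_eqF.
by rewrite {1}yE orb1 zeroM.
Qed.

Lemma exists_run b n j k z r : 1 < b -> (0 < n)%N -> b ^+ n * (b - 1) <= 2^-1 ->
    block_lo b n <= z <= block_hi b n ->
  exists s, (forall i, count_mem i s = r * (n * (i == j) + (i == k)))%N /\
    exists2 z', block_lo b n <= z' <= block_hi b n &
      orb b (between b j k z) s = between b j k z'.
Proof.
move=> b1 n0 small; elim: r z => [|r IH] z hz.
  by exists [::]; split=> //; exists z.
have [m mn hz1] := exists_block b1 n0 small hz.
have [s [cs [z' hz' orbz']]] := IH _ hz1.
exists (block n m j k ++ s); split=> [i|].
  by rewrite count_cat count_block // cs mulSn.
by exists z' => //; rewrite orb_cat orb_block.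
Qed.

Lemma sum_count s : (\sum_i count_mem i s)%N = size s.
Proof.
elim: s => [|a s IH] /=; first by rewrite big1.
rewrite big_split /= IH (bigD1 a) //= eqxx big1 // => i /negPf.
by rewrite eq_sym => ->.
Qed.

(** Here [t] counts the digits spent on transits. *)
Lemma exists_runs b n e : 1 < b -> (0 < n)%N -> (0 < M)%N ->
    4 * M%:R * (b - 1) <= 1 -> b ^+ n * (b - 1) <= 2^-1 ->
    0 < e -> e <= block_lo b n -> e <= (b - 1)^-1 - block_hi b n ->
  exists T, forall (r : 'I_M.+1 * 'I_M.+1 -> nat) y
      (js : seq ('I_M.+1 * 'I_M.+1)),
    core M b e y -> all (fun jk => jk.1 != jk.2) js ->
    exists s, core M b e (orb b y s) /\
      forall i, exists2 t, (t <= T * size js)%N &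
        count_mem i s =
          (t + \sum_(jk <- js) r jk * (n * (i == jk.1) + (i == jk.2)))%N.
Proof.
move=> b1 n0 M0 hM small e0 elo ehi.
have [T hT] := exists_transit b1 n0 M0 hM e0.
exists T => r y js; elim: js y => [|[j k] js IH] y yc.
  by move=> _; exists [::]; split=> // i; exists 0%N; rewrite ?big_nil.
move=> /andP[/= jk ajs].
have [s1 [s1T [z1 hz1 orb1]]] := hT y j k yc jk.
have [s2 [cs2 [z2 hz2 orb2]]] := exists_run j k (r (j, k)) b1 n0 small hz1.
have [|s3 [yc3 cs3]] := IH (orb b y (s1 ++ s2)) _ ajs.
  by rewrite orb_cat orb1 orb2; exact: (between_in_core b1 jk elo ehi (ltW e0)).
exists ((s1 ++ s2) ++ s3); rewrite orb_cat; split=> // i.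
have [t tT ci] := cs3 i.
exists (count_mem i s1 + t)%N.
  by rewrite /= mulnS leq_add // (leq_trans (count_size _ _) s1T).
rewrite big_cons !count_cat cs2 ci /= !addnA; congr addn.
by rewrite addnAC.
Qed.
End Steering.

(** * Expansions with prescribed frequencies *)

Section Construction.
Context {R : realType} {M : nat}.
Implicit Types (b x y z e : R) (n : nat) (i j k m : 'I_M.+1) (s : seq 'I_M.+1).
Implicit Types (p : 'I_M.+1 -> R).

(** Let [P = p m] be an entry at least [1 / (n + 1)]. Then [p] is the average,
with weights [p k / (1 - P)], of the vectors with mass [P] on [m] and [1 - P]
on [k]. As [P] lies between [1 / (n + 1)] and [n / (n + 1)], each of them is in
turn an average of the vectors of the pairs [(m, k)] and [(k, m)]. *)
Lemma Delta_eps_pairs n p : (0 < M)%N -> (M <= n)%N -> (1 < n)%N ->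
    Delta_eps n.+1%:R^-1 p ->
  exists w : 'I_M.+1 * 'I_M.+1 -> R,
    [/\ forall jk, 0 <= w jk, forall j, w (j, j) = 0 &
      forall i, \sum_jk w jk * (n * (i == jk.1) + (i == jk.2))%:R
                = n.+1%:R * p i].
Proof.
move=> M0 Mn n1 [p_le p_sum].
have n_pos : 0 < n.+1%:R :> R by [].
have [m pm] : exists m, n.+1%:R^-1 <= p m.
  apply: contrapT => no_large.
  have : \sum_i p i < \sum_(i < M.+1) n.+1%:R^-1.
    rewrite ltr_sum // => [|i _].
      by apply/hasP; exists ord0; rewrite ?mem_index_enum.
    by rewrite ltNge; apply/negP => h; apply: no_large; exists i.
  rewrite p_sum sumr_const card_ord -[ltRHS]mulr_natl ltr_pdivlMr // mul1r ltr_nat.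
  by rewrite ltnS ltnNge Mn.
have /andP[P0 P1] := p_le m; set P := p m in pm P0 P1.
have n1R : 0 < n%:R - 1 :> R by rewrite subr_gt0 ltr1n.
have P_lt1 : 0 < 1 - P.
  by rewrite subr_gt0 (le_lt_trans P1) // ltrBlDr ltrDl invr_gt0.
have nP : 0 <= n.+1%:R * P - 1.
  by rewrite subr_ge0 mulrC -ler_pdivrMr // mul1r.
have nP' : 0 <= n%:R - n.+1%:R * P.
  have := P1; rewrite -(ler_pM2l n_pos) mulrBr mulr1 divff ?gt_eqF //.
  by rewrite -natr1; lra.
(* [al] and [ga] solve [al + n * ga = n + 1] and
   [(n * al + ga) * (1 - P) = (n + 1) * P]. *)
pose al := (n.+1%:R * P - 1) / ((1 - P) * (n%:R - 1)).
pose ga := (n%:R - n.+1%:R * P) / ((1 - P) * (n%:R - 1)).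
have D0 : 0 < (1 - P) * (n%:R - 1) by rewrite mulr_gt0.
have al0 : 0 <= al by rewrite divr_ge0 // ltW.
have ga0 : 0 <= ga by rewrite divr_ge0 // ltW.
pose w (jk : 'I_M.+1 * 'I_M.+1) : R :=
  (if (jk.1 == m) && (jk.2 != m) then al * p jk.2 else 0) +
  (if (jk.1 != m) && (jk.2 == m) then ga * p jk.1 else 0).
have p0 i : 0 <= p i by have /andP[] := p_le i.
have rest : \sum_(i | i != m) p i = 1 - P.
  by rewrite -p_sum [in RHS](bigD1 m) //= [RHS]addrC addKr.
have row i : \sum_k w (i, k) = if i == m then al * (1 - P) else ga * p i.
  rewrite /w /= big_split /=; case: (i == m) => /=.
    by rewrite [X in _ + X]big1 // addr0 -big_mkcond -mulr_sumr rest.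
  by rewrite big1 // add0r -big_mkcond /= big_pred1_eq.
have col i : \sum_j w (j, i) = if i == m then ga * (1 - P) else al * p i.
  rewrite /w /= big_split /=; case: (i == m) => /=.
    rewrite big1 ?add0r => [|j _]; last by rewrite andbF.
    under eq_bigr do rewrite andbT.
    by rewrite -big_mkcond -mulr_sumr rest.
  rewrite [X in _ + X]big1 ?addr0 => [|j _]; last by rewrite andbF.
  under eq_bigr do rewrite andbT.
  by rewrite -big_mkcond /= big_pred1_eq.
exists w; split=> [jk|j|i].
- by rewrite /w addr_ge0 //; case: ifP => // _; rewrite mulr_ge0.
- by rewrite /w /=; case: (j == m); rewrite addr0.
transitivity (n%:R * \sum_k w (i, k) + \sum_j w (j, i)).
  rewrite -(pair_bigA _ (fun j k => w (j, k) * (n * (i == j) + (i == k))%:R)) /=.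
  under eq_bigr => j _.
    under eq_bigr => k _ do rewrite natrD mulrDr.
    rewrite big_split /= -mulr_suml.
    rewrite [X in _ + X](bigD1 i) //= eqxx mulr1 [X in _ + (_ + X)]big1 ?addr0.
      over.
    by move=> k; rewrite eq_sym => /negPf ->; rewrite mulr0.
  rewrite big_split /= (bigD1 i) //= eqxx muln1 [X in _ + X + _]big1 ?addr0.
    by rewrite mulrC.
  by move=> j; rewrite eq_sym => /negPf ->; rewrite muln0 mulr0.
rewrite row col; case: eqP => [->|_]; rewrite -/P /al /ga -natr1.
  by field; rewrite !gt_eqF.
by field; rewrite !gt_eqF.
Qed.

(** A stage takes [r * w jk] blocks, rounded down, of each pair; the transits
and the rounding cost an error that does not depend on [r]. *)
Lemma exists_stage b n e p : 1 < b -> (0 < M)%N -> (M <= n)%N -> (1 < n)%N ->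
    4 * M%:R * (b - 1) <= 1 -> b ^+ n * (b - 1) <= 2^-1 ->
    0 < e -> e <= block_lo b n -> e <= (b - 1)^-1 - block_hi b n ->
    Delta_eps n.+1%:R^-1 p ->
  exists C : R, forall (r : nat) y, core M b e y ->
    exists2 s, core M b e (orb b y s) &
      forall i, `|(count_mem i s)%:R - (r * n.+1)%:R * p i| <= C.
Proof.
move=> b1 M0 Mn n1 hM small e0 elo ehi hp.
have [w [w0 wdiag wsum]] := Delta_eps_pairs M0 Mn n1 hp.
have [T hT] := exists_runs b1 (ltnW n1) M0 hM small e0 elo ehi.
pose js := enum [pred jk : 'I_M.+1 * 'I_M.+1 | jk.1 != jk.2].
exists (T * size js + #|{: 'I_M.+1 * 'I_M.+1}| * n.+1)%:R => r y yc.
pose cnt jk := Num.truncn (r%:R * w jk).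
have [|s [sc hs]] := hT cnt y js yc.
  by apply/allP => jk; rewrite mem_enum.
exists s => // i; have [t tT ->] := hs i.
have -> : (\sum_(jk <- js) cnt jk * (n * (i == jk.1) + (i == jk.2)) =
    \sum_jk cnt jk * (n * (i == jk.1) + (i == jk.2)))%N.
  rewrite big_enum /= [RHS](bigID [pred jk : 'I_M.+1 * 'I_M.+1 | jk.1 != jk.2]) /=.
  rewrite [X in (_ + X)%N]big1 ?addn0 // => -[j k] /=; rewrite negbK => /eqP ->.
  by rewrite /cnt wdiag mulr0 truncn0.
rewrite natrM -mulrA -wsum mulr_sumr natrD natr_sum -addrA -sumrB natrD.
apply: le_trans (ler_normD _ _) _; apply: lerD.
  by rewrite ger0_norm // ler_nat.
apply: le_trans (ler_norm_sum _ _ _) _.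
rewrite natrM -sum1_card natr_sum mulr_suml; apply: ler_sum => jk _.
rewrite natrM mulrA -mulrBl normrM mul1r -[leRHS]mul1r.
apply: ler_pM => //.
  have := truncn_itv (mulr_ge0 (ler0n _ r) (w0 jk)).
  rewrite -/(cnt jk) -natr1 => /andP[? ?].
  by rewrite ler_norml; apply/andP; split; lra.
rewrite ger0_norm // ler_nat -[leqRHS]addn1 leq_add ?leq_b1 //.
by rewrite -[leqRHS]muln1 leq_mul2l leq_b1 orbT.
Qed.

(** Stage [r] of the construction has the parameter [r + R0], which makes its
length greater than [r]. *)
Lemma Delta_eps_sub_Delta_beta b n x : (0 < M)%N -> (M <= n)%N -> (1 < n)%N ->
    1 < b -> 4 * M%:R * (b - 1) <= 1 -> b ^+ n * (b - 1) <= 2^-1 ->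
    0 < x < M%:R / (b - 1) ->
  @Delta_eps R M n.+1%:R^-1 `<=` Delta_beta b x.
Proof.
move=> M0 Mn n1 b1 hM small /andP[x0 xM] p hp.
have [lo0 lohi hiq _ _] := block_range b1 (ltnW n1).
pose e := Num.min (Num.min x (M%:R / (b - 1) - x))
  (Num.min (block_lo b n) ((b - 1)^-1 - block_hi b n)).
have e0 : 0 < e by rewrite !lt_min x0 lo0 !subr_gt0 xM.
have ex : e <= x by rewrite !ge_min lexx.
have ex' : e <= M%:R / (b - 1) - x by rewrite !ge_min lexx orbT.
have elo : e <= block_lo b n by rewrite !ge_min lexx !orbT.
have ehi : e <= (b - 1)^-1 - block_hi b n by rewrite !ge_min lexx !orbT.
have [C stage] := exists_stage b1 M0 Mn n1 hM small e0 elo ehi hp.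
have [p_le p_sum] := hp.
have p0 k : 0 <= p k by have /andP[] := p_le k.
have p01 k : 0 <= p k <= 1.
  by rewrite p0 -p_sum (bigD1 k) //= lerDl sumr_ge0.
have xc : core M b e x by apply/andP; split; lra.
have C0 : 0 <= C.
  by have [s _ /(_ ord0)] := stage 0%N x xc; exact: le_trans.
pose R0 := (Num.truncn (M.+1%:R * C)).+1.
have R0C : M.+1%:R * C < R0%:R by exact: truncnS_gt.
have stageP (ry : nat * R) : exists s, core M b e ry.2 ->
    core M b e (orb b ry.2 s) /\
    forall i, `|(count_mem i s)%:R - ((ry.1 + R0) * n.+1)%:R * p i| <= C.
  case: ry => r y; have [yc|ync] := pselect (core M b e y); last by exists [::].
  by have [s sc hs] := stage (r + R0)%N y yc; exists s.
have [f fP] := choice stageP.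
pose Y := fix Y r := if r is r'.+1 then orb b (Y r') (f (r', Y r')) else x.
pose U r := f (r, Y r).
have Ycore r : core M b e (Y r).
  elim: r => [|r IH]; first exact: xc.
  by have [] := fP (r, Y r) IH.
have orbU r : orb b x (concat_prefix U r) = Y r.
  by elim: r => [//|r IH]; rewrite concat_prefixS orb_cat IH.
have Ucount r i : `|(count_mem i (U r))%:R - ((r + R0) * n.+1)%:R * p i| <= C.
  by have [] := fP (r, Y r) (Ycore r).
have Usize r : `|(size (U r))%:R - ((r + R0) * n.+1)%:R| <= M.+1%:R * C.
  have <- : \sum_i ((r + R0) * n.+1)%:R * p i = ((r + R0) * n.+1)%:R.
    by rewrite -mulr_sumr p_sum mulr1.
  rewrite -sum_count natr_sum -sumrB.
  apply: le_trans (ler_norm_sum _ _ _) _.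
  apply: le_trans (ler_sum _ (fun i _ => Ucount r i)) _.
  by rewrite sumr_const card_ord mulr_natl.
pose S := M.+1%:R * C.
have S0 : 0 <= S by rewrite mulr_ge0.
have Usize_gt r : (r < size (U r))%N.
  rewrite -(ltr_nat R); have := Usize r; rewrite ler_norml => /andP[h _].
  have : (r + R0)%:R <= ((r + R0) * n.+1)%:R :> R by rewrite ler_nat leq_pmulr.
  by move: h R0C; rewrite natrD; lra.
pose C' := (R0.+1 * n.+1)%:R + S + C.
split; first by split.
exists (concat ord0 U).
  apply: (@Sigma_concat _ _ _ _ (M%:R / (b - 1))) => // r.
  by rewrite orbU; have /andP[? ?] := Ycore r; apply/andP; split; lra.
apply: (@has_freq_concat _ _ _ C') => // [r|r k].
  have := Usize r; rewrite ler_norml => /andP[_ h].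
  have h1 : ((r + R0) * n.+1)%:R <= (R0.+1 * n.+1)%:R * r.+1%:R :> R.
    rewrite -natrM ler_nat mulnAC leq_mul2r mulSn; apply/orP; right.
    by rewrite leq_add // leq_pmulr.
  have h2 : S <= S * r.+1%:R by rewrite ler_peMr // ler1n.
  have h3 : 0 <= C * r.+1%:R by rewrite mulr_ge0.
  by rewrite /C' !mulrDl; move: h; rewrite -/S; lra.
have -> : discrepancy p k (U r) =
    ((count_mem k (U r))%:R - ((r + R0) * n.+1)%:R * p k) -
    p k * ((size (U r))%:R - ((r + R0) * n.+1)%:R).
  by rewrite /discrepancy; ring.
apply: le_trans (ler_normB _ _) _.
have h1 : `|p k * ((size (U r))%:R - ((r + R0) * n.+1)%:R)| <= S.
  have /andP[pk0 pk1] := p01 k.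
  by rewrite normrM (ger0_norm pk0) -[S]mul1r; apply: ler_pM.
have h2 : 0 <= (R0.+1 * n.+1)%:R :> R by [].
by have := Ucount r k; rewrite /C'; lra.
Qed.

End Construction.

(** * Points without sparse expansions *)

Section SparseWords.
Context {R : realType} {M : nat}.
Implicit Types (b x theta tau : R) (N : nat) (d : 'I_M.+1).

Definition nonzeros N (w : {ffun 'I_N -> 'I_M.+1}) : nat :=
  #|[pred i | w i != ord0]|.

Definition sparse theta N : pred {ffun 'I_N -> 'I_M.+1} :=
  [pred w | (nonzeros w)%:R <= theta * N%:R].

(** Chernoff bound: each word gets the weight [expR (tau * (theta * N -
nonzeros))], which is at least [1] on sparse words and has a total that factors
over the letters. *)
Lemma card_sparse theta tau N : 0 <= tau ->
  #|@sparse theta N|%:R <= (expR (tau * theta) * (1 + M%:R * expR (- tau))) ^+ N.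
Proof.
move=> tau0.
pose F d : R := expR (tau * theta) * (if d == ord0 then 1 else expR (- tau)).
have sumF : \sum_d F d = expR (tau * theta) * (1 + M%:R * expR (- tau)).
  rewrite -mulr_sumr (bigD1 ord0) //=; congr (_ * (_ + _)).
  rewrite (eq_bigr (fun=> expR (- tau))) => [|d /negPf -> //].
  rewrite sumr_const mulr_natl; congr (_ *+ _).
  by have := cardC1 (ord0 : 'I_M.+1); rewrite card_ord.
have -> : (expR (tau * theta) * (1 + M%:R * expR (- tau))) ^+ N =
    \sum_(w : {ffun 'I_N -> 'I_M.+1}) \prod_i F (w i).
  by rewrite -sumF -(bigA_distr_bigA (fun _ : 'I_N => F)) prodr_const card_ord.
rewrite -sum1_card natr_sum big_mkcond /=; apply: ler_sum => w _.
have F0 d : 0 <= F d.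
  by rewrite mulr_ge0 ?expR_ge0 //; case: ifP => // _; exact: expR_ge0.
case: ifPn => [|_]; last by rewrite prodr_ge0.
rewrite inE => wS.
have -> : \prod_i F (w i) =
    expR (tau * (theta * N%:R - (nonzeros w)%:R)).
  rewrite big_split /= prodr_const card_ord -expRM_natl.
  rewrite (bigID [pred i | w i != ord0]) /= [X in _ * (_ * X)]big1 => [|i]; last first.
    by rewrite negbK => ->.
  rewrite mulr1 (eq_bigr (fun=> expR (- tau))) => [|i /negPf -> //].
  by rewrite prodr_const -expRM_natl -expRD /nonzeros; congr expR; ring.
by rewrite -[leLHS]expR0 ler_expR mulr_ge0 // subr_ge0.
Qed.

Definition word_value b N (w : {ffun 'I_N -> 'I_M.+1}) : R :=
  \sum_i (w i : nat)%:R / b ^+ i.+1.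

(** Contains every point with an expansion in base [b] that starts with a
sparse word of length [N]. *)
Definition sparse_cover b theta N : set R :=
  \big[setU/set0]_(w : {ffun 'I_N -> 'I_M.+1} | sparse theta w)
    `[word_value b w, word_value b w + M%:R / (b - 1) / b ^+ N]%classic.

Lemma le_measure_bigsetU disp (T : measurableType disp)
    (mu : {measure set T -> \bar R}) (I : Type) (s : seq I) (P : pred I) (A : I -> set T) :
    (forall i, measurable (A i)) ->
  (mu (\big[setU/set0]_(i <- s | P i) A i) <= \sum_(i <- s | P i) mu (A i))%E.
Proof.
move=> mA; elim: s => [|i s IH]; first by rewrite !big_nil measure0.
rewrite !big_cons; case: ifP => // Pi.
apply: le_trans (measureU2 _ _ _) _ => //; first exact: bigsetU_measurable.
exact: leeD2l.
Qed.

Lemma measurable_sparse_cover b theta N : measurable (sparse_cover b theta N).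
Proof. by apply: bigsetU_measurable => w _; exact: measurable_itv. Qed.

Lemma measure_sparse_cover b theta tau N : 1 < b -> 0 <= tau ->
  (lebesgue_measure (sparse_cover b theta N) <=
   (M%:R / (b - 1) *
    (expR (tau * theta) * (1 + M%:R * expR (- tau)) / b) ^+ N)%:E)%E.
Proof.
move=> b1 tau0; have bN : 0 < b ^+ N by rewrite exprn_gt0 //; lra.
have C0 : 0 <= M%:R / (b - 1) / b ^+ N.
  by rewrite !divr_ge0 //; [rewrite subr_ge0 ltW|exact: ltW].
apply: le_trans (le_measure_bigsetU _ _ _ _) _ => [w|]; first exact: measurable_itv.
rewrite (eq_bigr (fun=> (M%:R / (b - 1) / b ^+ N)%:E)) => [|w _]; last first.
  apply: etrans (lebesgue_measure_itv _) _; rewrite /= lte_fin ltrDl.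
  case: ltP => C0'; first by rewrite -EFinD addrC addKr.
  by congr EFin; apply/eqP; rewrite eq_le C0 C0'.
rewrite sumEFin lee_fin sumr_const -[leLHS]mulr_natl expr_div_n.
rewrite [leRHS]mulrCA; apply: ler_wpM2r => //; exact: card_sparse.
Qed.

Lemma series_tail b (a : nat -> 'I_M.+1) x N : 1 < b -> Sigma b x a ->
  \sum_(i < N) (a i : nat)%:R / b ^+ i.+1 <= x <=
  \sum_(i < N) (a i : nat)%:R / b ^+ i.+1 + M%:R / (b - 1) / b ^+ N.
Proof.
move=> b1; rewrite /Sigma /=; set u := (X in series X) => ux.
have b0 : 0 < b by lra.
have u0 i : 0 <= u i by rewrite /u divr_ge0 // exprn_ge0 // ltW.
have -> : \sum_(i < N) (a i : nat)%:R / b ^+ i.+1 = series u N.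
  by rewrite /series /= big_mkord.
have xE : x = limn (series u) by apply/esym/cvg_lim.
have cu : cvgn (series u) by apply/cvg_ex; exists x.
have C0 : 0 <= M%:R / (b - 1) by rewrite divr_ge0 // subr_ge0 ltW.
have tail m : (N <= m)%N ->
    series u m + M%:R / (b - 1) / b ^+ m <= series u N + M%:R / (b - 1) / b ^+ N.
  move=> /subnKC <-; elim: (m - N)%N => [|k IH]; first by rewrite addn0.
  apply: le_trans IH; rewrite addnS seriesSr -addrA lerD2l /u exprS.
  have aM : (a (N + k)%N : nat)%:R <= M%:R :> R by rewrite ler_nat -ltnS.
  have bk : 0 < b ^+ (N + k) by rewrite exprn_gt0.
  have -> : M%:R / (b - 1) / b ^+ (N + k) =
      (M%:R / (b * b ^+ (N + k))) + M%:R / (b - 1) / (b * b ^+ (N + k)).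
    by field; rewrite !gt_eqF //; lra.
  by rewrite lerD2r ler_wpM2r // invr_ge0 mulr_ge0 // ltW.
rewrite xE; apply/andP; split.
  apply: limr_ge => //; exists N => // m /= Nm.
  by rewrite -subr_ge0 sub_series_geq // sumr_ge0.
apply: limr_le => //; exists N => // m /= Nm.
apply: le_trans (tail m Nm); rewrite lerDl divr_ge0 //.
by rewrite exprn_ge0 // ltW.
Qed.

Lemma eventually_sparse (a : nat -> 'I_M.+1) theta (p : R) : 1 - theta < p ->
  has_freq a ord0 p ->
  exists N0, forall N, (N0 <= N)%N -> sparse theta [ffun i : 'I_N => a i].
Proof.
move=> thp /cvgrPdist_lt /(_ (p - (1 - theta))).
rewrite subr_gt0 => /(_ thp)[N0 _ hN0].
exists N0.+1 => N hN; rewrite /sparse /=.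
have N_pos : 0 < N%:R :> R by rewrite ltr0n; case: N hN.
have := hN0 N (ltnW hN); rewrite /= ltr_distl => /andP[_].
have : (nonzeros [ffun i : 'I_N => a i] + #|[pred i : 'I_N | a i == ord0]| = N)%N.
  rewrite -[RHS]card_ord -[RHS](cardC [pred i : 'I_N | a i == ord0]) addnC.
  by congr (_ + _)%N; apply: eq_card => i; rewrite !inE ffunE.
move=> /(congr1 (fun m => m%:R : R)); rewrite natrD.
set z := #|[pred i : 'I_N | a i == ord0]|%:R => nzE h.
have : (1 - theta) * N%:R < z.
  by rewrite -ltr_pdivlMr //; lra.
have : (nonzeros [ffun i : 'I_N => a i])%:R = N%:R - z by rewrite -nzE addrK.
by move=> ->; lra.
Qed.

(** The covers have summable measures, so almost every point lies in finitely
many of them, whereas a point with an expansion of frequency vector [p] lies in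
all of them from some length on. *)
Lemma exists_not_Delta_beta b theta tau (p : 'I_M.+1 -> R) :
    (0 < M)%N -> 1 < b -> 0 <= tau ->
    expR (tau * theta) * (1 + M%:R * expR (- tau)) < b ->
    1 - theta < p ord0 ->
  exists2 x : R, 0 < x < M%:R / (b - 1) & ~ Delta_beta b x p.
Proof.
move=> M0 b1 tau0; set g := _ * _ => gb thp.
apply: contrapT => all_in.
have b0 : 0 < b by lra.
have C_pos : 0 < M%:R / (b - 1) by rewrite divr_gt0 ?ltr0n // subr_gt0.
have g0 : 0 <= g by rewrite mulr_ge0 ?expR_ge0 // addr_ge0 // mulr_ge0 // expR_ge0.
have null : lebesgue_measure (lim_sup_set (sparse_cover b theta)) = 0%E.
  apply: lim_sup_set_cvg0 => [N|]; first exact: measurable_sparse_cover.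
  pose rho := g / b.
  have rho1 : `|rho| < 1.
    by rewrite ger0_norm ?ltr_pdivrMr ?mul1r // divr_ge0 // ltW.
  have sum_rho : (\sum_(N <oo) (geometric (M%:R / (b - 1)) rho N)%:E =
      (M%:R / (b - 1) / (1 - rho))%:E)%E.
    apply/cvg_lim => //; apply: cvg_EFin.
      by apply: nearW => m /=; rewrite sumEFin.
    rewrite [X in X @ _ --> _](_ : _ = series (geometric (M%:R / (b - 1)) rho)).
      exact: cvg_geometric_series.
    by apply/funext => m; rewrite /= sumEFin.
  apply: (@le_lt_trans _ _ (\sum_(N <oo) (geometric (M%:R / (b - 1)) rho N)%:E)%E).
    by apply: lee_nneseries => N _ //; exact: measure_sparse_cover.
  by rewrite sum_rho ltry.
pose I : set R := `]0, M%:R / (b - 1)[%classic.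
have sub : I `<=` lim_sup_set (sparse_cover b theta).
  move=> x; rewrite /I /= in_itv /= => hx K _.
  have [_ [a xa afreq]] : Delta_beta b x p.
    by apply: contrapT => xp; apply: all_in; exists x.
  have [N0 sparseN] := eventually_sparse thp (afreq ord0).
  exists (maxn K N0); first exact: leq_maxl.
  rewrite /sparse_cover -bigcup_seq_cond.
  exists [ffun i : 'I_(maxn K N0) => a i] => /=.
    by rewrite mem_index_enum sparseN // leq_maxr.
  rewrite in_itv /= /word_value.
  rewrite (eq_bigr (fun i : 'I_(maxn K N0) => (a i : nat)%:R / b ^+ i.+1)) => [|i _].
    exact: series_tail.
  by rewrite ffunE.
have : (lebesgue_measure I <= 0)%E.
  rewrite -null; apply: le_measure => //; rewrite inE.
    exact: measurable_itv.
  apply: bigcap_measurable => // k _; apply: bigcup_measurable => // N _.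
  exact: measurable_sparse_cover.
rewrite /I lebesgue_measure_itv /= lte_fin C_pos sube0 lee_fin.
by rewrite leNgt C_pos.
Qed.
End SparseWords.

(** * Explicit bounds on the bases *)

Section Bounds.
Context {R : realType}.
Implicit Types (M n : nat) (b : R).

(** Chosen so that [lower_base n ^+ n] is at most [n / (2 * ln n)], hence its
product with [lower_base n - 1] at most [1 / 2]. *)
Definition lower_base n : R := 1 + (ln n%:R - ln (2 * ln n%:R)) / n%:R.

(** Bounds the growth rate [expR (ln n / n) * (1 + M / n)] of the sparse words
without the exponential, see [upper_base_ge]. *)
Definition upper_base M n : R := (1 + M%:R / n%:R) / (1 - ln n%:R / n%:R).

Lemma beta_zeroP n : (0 < n)%N ->
  1 < beta R n /\ beta R n ^+ n * (beta R n - 1) = 1.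
Proof.
move=> n0; have [z [hz _]] := exists_unique_beta_zero R n0.
have [/andP[h1 _] hbeta] : beta_zero n (beta R n) by apply: xgetPex; exists z.
split=> //; move: hbeta. rewrite /Defs.beta_fun exprSr mulrBr mulr1.
by move=> /subr0_eq.
Qed.

Lemma lt_expr_mul_subr1 n b b' : 1 < b -> b < b' ->
  b ^+ n * (b - 1) < b' ^+ n * (b' - 1).
Proof.
move=> b1 bb'; apply: (@le_lt_trans _ _ (b' ^+ n * (b - 1))).
  by apply: ler_wpM2r; [lra|apply: lerXn2r; rewrite ?nnegrE; lra].
by rewrite ltr_pM2l ?ltrD2r //; apply: exprn_gt0; lra.
Qed.

Lemma lower_base_bounds n : (0 < n)%N -> 1 <= 2 * ln (n%:R : R) ->
    ln (2 * ln n%:R) < ln n%:R :> R ->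
  [/\ 1 < lower_base n, lower_base n - 1 <= ln n%:R / n%:R &
      lower_base n ^+ n * (lower_base n - 1) <= 2^-1].
Proof.
move=> n0 t1 lnt; set t := ln n%:R in t1 lnt *.
have nR : 0 < n%:R :> R by rewrite ltr0n.
have LE : lower_base n - 1 = (t - ln (2 * t)) / n%:R.
  by rewrite /lower_base -/t addrC addKr.
have L1 : 1 < lower_base n.
  by rewrite -subr_gt0 LE divr_gt0 // subr_gt0.
have Lt : lower_base n - 1 <= t / n%:R.
  by rewrite LE ler_pM2r ?invr_gt0 // gerBl ln_ge0.
split=> //.
have t0 : 0 < t by lra.
have Ln : lower_base n ^+ n <= n%:R / (2 * t).
  have -> : n%:R / (2 * t) = expR (t - ln (2 * t)).
    by rewrite expRD expRN !lnK // posrE; lra.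
  have -> : t - ln (2 * t) = n%:R * (lower_base n - 1).
    by rewrite LE [RHS]mulrC divfK // gt_eqF.
  rewrite expRM_natl; apply: lerXn2r; rewrite ?nnegrE ?expR_ge0 //; first lra.
  by have := expR_ge1Dx (lower_base n - 1); lra.
apply: le_trans (ler_pM _ _ Ln Lt) _; first by rewrite exprn_ge0 //; lra.
  lra.
by rewrite le_eqVlt; apply/orP; left; apply/eqP; field; rewrite !gt_eqF.
Qed.

Lemma upper_base_ge M n : ln (n%:R : R) / n%:R < 1 ->
  expR (ln n%:R / n%:R) * (1 + M%:R / n%:R) <= upper_base M n.
Proof.
move=> h1; rewrite /upper_base mulrC; apply: ler_wpM2l.
  by rewrite addr_ge0 // divr_ge0.
rewrite -[leLHS]invrK -expRN lef_pV2 ?posrE ?expR_gt0 ?subr_gt0 //.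
exact: expR_ge1Dx.
Qed.

Lemma beta_ge_lower_base n : (0 < n)%N -> 1 <= 2 * ln (n%:R : R) ->
    ln (2 * ln n%:R) < ln n%:R :> R ->
  lower_base n <= beta R n.
Proof.
move=> n0 t1 lnt; have [L1 _ small] := lower_base_bounds n0 t1 lnt.
have [b1 bE] := beta_zeroP n0.
rewrite leNgt; apply/negP => /(lt_expr_mul_subr1 n b1).
by rewrite bE; lra.
Qed.

Lemma beta_le_upper_base M n : (0 < n)%N -> 1 <= ln (n%:R : R) ->
    ln (n%:R : R) / n%:R < 1 ->
  beta R n <= upper_base M n.
Proof.
move=> n0 t1 h1; set h := ln n%:R / n%:R in h1.
have nR : 0 < n%:R :> R by rewrite ltr0n.
have h0 : 0 < h by rewrite divr_gt0 //; lra.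
have [b1 bE] := beta_zeroP n0.
apply: le_trans (upper_base_ge M h1); rewrite -/h.
apply: (@le_trans _ _ (expR h)); last first.
  by rewrite ler_peMr ?expR_ge0 // lerDl divr_ge0.
have eh1 : 1 < expR h by rewrite expR_gt1.
rewrite leNgt; apply/negP => /(lt_expr_mul_subr1 n eh1).
rewrite bE -expRM_natl.
have -> : n%:R * h = ln n%:R by rewrite /h mulrC divfK // gt_eqF.
rewrite lnK ?posrE // ltNge => /negP; apply.
apply: le_trans t1 _.
have -> : ln n%:R = n%:R * h by rewrite /h mulrC divfK // gt_eqF.
by rewrite ler_pM2l // lerBrDl expR_ge1Dx.
Qed.

Definition good_base M n : set R :=
  [set bs : R | 1 < bs <= M.+1%:R /\
    forall b, 1 < b < bs -> forall x, 0 < x < M%:R / (b - 1) ->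
      @Delta_eps R M n.+1%:R^-1 `<=` Delta_beta b x].

Lemma lower_base_good M n : (0 < M)%N -> (M <= n)%N -> (1 < n)%N ->
    1 <= 2 * ln (n%:R : R) -> ln (2 * ln n%:R) < ln n%:R :> R ->
    4 * M%:R * (ln n%:R / n%:R) <= 1 :> R ->
  good_base M n (lower_base n).
Proof.
move=> M0 Mn n1 t1 lnt hM; have [L1 Lh small] := lower_base_bounds (ltnW n1) t1 lnt.
have M1 : 1 <= M%:R :> R by rewrite ler1n.
have h1 : ln n%:R / n%:R <= 1 :> R.
  apply: le_trans hM; rewrite ler_peMl //; last lra.
  by rewrite divr_ge0 //; lra.
split; first by rewrite L1 /= -natr1; lra.
move=> b /andP[b1 bL] x hx; apply: (@Delta_eps_sub_Delta_beta _ _ b n) => //.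
  by apply: le_trans hM; apply: ler_wpM2l; [lra|lra].
by apply: le_trans small; apply: ltW; exact: lt_expr_mul_subr1.
Qed.

(** The vector with mass [1 - 1 / (n + 1)] on [0] and [1 / (n + 1)] on [M] is
admissible, but not attained everywhere in a base above [upper_base M n], since
[1 - 1 / n < 1 - 1 / (n + 1)]. *)
Lemma good_base_le_upper_base M n bs : (0 < M)%N -> (1 < n)%N ->
    ln (n%:R : R) / n%:R < 1 -> good_base M n bs ->
  bs <= upper_base M n.
Proof.
move=> M0 n1 h1 [_ good]; rewrite leNgt; apply/negP => Ubs.
have nR : 0 < n%:R :> R by rewrite ltr0n ltnW.
have n1R : 1 <= n%:R :> R by rewrite ler1n ltnW.
have t0 : 0 <= ln (n%:R : R) by rewrite ln_ge0.
have U1 : 1 <= upper_base M n.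
  apply: le_trans (upper_base_ge M h1).
  rewrite -[leLHS]mulr1; apply: ler_pM => //.
    by rewrite -[leLHS]expR0 ler_expR divr_ge0.
  by rewrite lerDl divr_ge0.
pose b := (upper_base M n + bs) / 2.
have Ub : upper_base M n < b by rewrite /b; lra.
have bbs : b < bs by rewrite /b; lra.
pose p (k : 'I_M.+1) : R :=
  if k == ord0 then 1 - n.+1%:R^-1 else if k == ord_max then n.+1%:R^-1 else 0.
have pD : Delta_eps n.+1%:R^-1 p.
  have n10 : 0 < n.+1%:R^-1 :> R by rewrite invr_gt0.
  have n12 : n.+1%:R^-1 <= 2^-1 :> R.
    by rewrite lef_pV2 ?posrE // ler_nat ltnW.
  split=> [k|].
    rewrite /p; move: (n.+1%:R^-1) n10 n12 => e e0 e2.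
    by case: ifP => _; [|case: ifP => _]; apply/andP; split; lra.
  rewrite (bigD1 ord0) //= (bigD1 ord_max) /=; last first.
    by rewrite -(inj_eq val_inj) /= -lt0n.
  rewrite big1 => [|k /andP[/negPf k0 /negPf kM]]; last by rewrite /p k0 kM.
  by rewrite /p eqxx -(inj_eq val_inj) /= eqn0Ngt M0 /= eqxx addr0 subrK.
have [|||x hx xp] := @exists_not_Delta_beta R M b n%:R^-1 (ln n%:R) p M0 _ t0.
- by lra.
- rewrite expRN lnK ?posrE //; apply: le_lt_trans Ub; exact: upper_base_ge.
- by rewrite /p eqxx ltrD2l ltrN2 ltf_pV2 ?posrE // ltr_nat.
by apply: xp; apply: (good b) => //; rewrite bbs andbT; lra.
Qed.

Lemma beta_star_bounds M n : (0 < M)%N -> (M <= n)%N -> (1 < n)%N ->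
    1 <= 2 * ln (n%:R : R) -> ln (2 * ln n%:R) < ln n%:R :> R ->
    4 * M%:R * (ln n%:R / n%:R) <= 1 :> R -> ln (n%:R : R) / n%:R < 1 ->
  lower_base n <= beta_star R M n <= upper_base M n.
Proof.
move=> M0 Mn n1 t1 lnt hM h1.
have good := lower_base_good M0 Mn n1 t1 lnt hM.
apply/andP; split.
  apply: ub_le_sup good; exists M.+1%:R => bs [/andP[_ ?] _] //.
by apply: ge_sup => [|bs]; [exists (lower_base n)|exact: good_base_le_upper_base].
Qed.
End Bounds.

(** * Asymptotics *)

Section Limits.
Context {R : realType}.
Implicit Types (u v w : nat -> R).

Lemma cvg_ln_pinfty u : u n @[n --> \oo] --> +oo ->
  ln (u n) @[n --> \oo] --> +oo.
Proof.
move=> /cvgryPge uoo; apply/cvgryPge => A.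
apply: filterS (uoo (expR A)) => n hn.
by rewrite -[A]expRK ler_ln // posrE ?expR_gt0 // (lt_le_trans _ hn) ?expR_gt0.
Qed.

Lemma cvg_inv_pinfty u : u n @[n --> \oo] --> +oo ->
  (u n)^-1 @[n --> \oo] --> (0 : R).
Proof.
move=> uoo; apply/(@gtr0_cvgV0 _ _ _ _ u) => //.
exact/(cvgryPgt u).1.
Qed.

(** From [(ln x) ^+ 2 / 2 <= x] one gets [ln x / x <= 2 / ln x]. *)
Lemma cvg_ln_div u : u n @[n --> \oo] --> +oo ->
  ln (u n) / u n @[n --> \oo] --> (0 : R).
Proof.
move=> uoo; have luoo := cvg_ln_pinfty uoo.
apply: (@squeeze_cvgr _ _ _ _ (fun=> 0) (fun n => 2 * (ln (u n))^-1)).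
- move/cvgryPge/(_ 1): luoo; move/cvgryPge/(_ 1): uoo; apply: filterS2 => n u1 l1.
  have u0 : 0 < u n by lra.
  have l0 : 0 < ln (u n) by lra.
  apply/andP; split; first by rewrite divr_ge0 // ltW.
  rewrite ler_pdivrMr // mulrAC ler_pdivlMr //.
  have := expR_ge1Dxn 1 (ltW l0); rewrite lnK ?posrE // expr2.
  have -> : (2`! = 2)%N by [].
  by move=> ?; lra.
- exact: cvg_cst.
- rewrite -[X in _ --> X](mulr0 2); apply: cvgM; first exact: cvg_cst.
  exact: cvg_inv_pinfty.
Qed.

Lemma cvg_near_eq u v (l : R) : (\forall n \near \oo, u n = v n) ->
  u n @[n --> \oo] --> l -> v n @[n --> \oo] --> l.
Proof. by move=> uv; apply: cvg_trans; exact: near_eq_cvg. Qed.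

Lemma asymp_equiv_of_ratio u v w : (\forall n \near \oo, w n != 0) ->
    u n / w n @[n --> \oo] --> (1 : R) -> v n / w n @[n --> \oo] --> (1 : R) ->
  asymp_equiv u v.
Proof.
move=> w0 uw vw; rewrite /asymp_equiv -[X in _ --> X](divr1 1).
have : (u n / w n) / (v n / w n) @[n --> \oo] --> (1 / 1 : R).
  by apply: cvgM => //; apply: cvgV.
apply: cvg_near_eq; apply: filterS w0 => n wn.
by rewrite invf_div mulrA divfK.
Qed.
End Limits.

Unset Implicit Arguments.

Theorem corollary1p7 (R : realType) (M : nat) (hM : (0 < M)%N) :
  asymp_equiv (fun n : nat => beta R n - 1)
    (fun n : nat => beta_star R M n - 1) /\
  asymp_equiv (fun n : nat => beta_star R M n - 1)
    (fun n : nat => ln (n%:R : R) / n%:R).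
Proof.
pose t n : R := ln n%:R.
pose h n : R := t n / n%:R.
have noo : (n%:R : R) @[n --> \oo] --> +oo by exact: cvgr_idn.
have too : t n @[n --> \oo] --> +oo := cvg_ln_pinfty noo.
have h0 : h n @[n --> \oo] --> (0 : R) := cvg_ln_div noo.
have t2oo : 2 * t n @[n --> \oo] --> +oo.
  apply/cvgryPge => A; have /cvgryPge/(_ (A / 2)) := too.
  by apply: filterS => n; lra.
have lt0 : ln (2 * t n) / t n @[n --> \oo] --> (0 : R).
  apply: (@cvg_near_eq _ (fun n => 2 * (ln (2 * t n) / (2 * t n)))); last first.
    rewrite -[X in _ --> X](mulr0 2).
    by apply: cvgM; [exact: cvg_cst|exact: cvg_ln_div].
  have /cvgryPge/(_ 1) := too; apply: filterS => n tn.
  by field; rewrite gt_eqF //; lra.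
have near_pos : \forall n \near \oo, [/\ (maxn M 2 <= n)%N, 1 <= t n,
    ln (2 * t n) < t n, 4 * M%:R * h n <= 1 & h n < 1].
  have e0 : 0 < (4 * M%:R)^-1 :> R by rewrite invr_gt0 mulr_gt0 // ltr0n.
  near=> n; have t1 : 1 <= t n by near: n; exact: (cvgryPge t).1.
  split=> //.
  - by near: n; exists (maxn M 2).
  - have : ln (2 * t n) / t n < 1.
      by near: n; apply: cvgr_lt lt0 _ _; lra.
    by rewrite ltr_pdivrMr ?mul1r //; lra.
  - have : h n < (4 * M%:R)^-1 by near: n; exact: cvgr_lt h0 _ _.
    rewrite -[X in _ < X]mul1r ltr_pdivlMr 1?mulrC => [/ltW//|].
    by rewrite mulr_gt0 // ltr0n.
  - by near: n; apply: cvgr_lt h0 _ _; lra.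
have pos_of_ge n : (maxn M 2 <= n)%N -> 0 < n%:R :> R.
  by rewrite geq_max ltr0n => /andP[_ /ltnW].
pose l n : R := lower_base n - 1.
pose m n : R := upper_base M n - 1.
have lh : l n / h n @[n --> \oo] --> (1 : R).
  apply: (@cvg_near_eq _ (fun n => 1 - ln (2 * t n) / t n)); last first.
    by rewrite -[X in _ --> X](subr0 1); apply: cvgB => //; exact: cvg_cst.
  apply: filterS near_pos => n.
  move=> [n2 t1 _ _ _]; rewrite /l /h /lower_base -/(t n).
  have nR := pos_of_ge n n2.
  by field; rewrite !gt_eqF //; lra.
have mh : m n / h n @[n --> \oo] --> (1 : R).
  have : (1 + M%:R * (t n)^-1) / (1 - h n) @[n --> \oo] -->
      ((1 + M%:R * 0) / (1 - 0) : R).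
    apply: cvgM.
      apply: cvgD; first exact: cvg_cst.
      by apply: cvgM; [exact: cvg_cst|exact: cvg_inv_pinfty].
    apply: cvgV; first by rewrite subr0 oner_neq0.
    by apply: cvgB => //; exact: cvg_cst.
  rewrite mulr0 addr0 subr0 divr1.
  apply: cvg_near_eq; apply: filterS near_pos => n.
  move=> [n2 t1 _ _]; rewrite /m /h /upper_base -/(t n) => h1.
  have nR := pos_of_ge n n2.
  have tn : t n < n%:R by rewrite -[ltRHS]mul1r -ltr_pdivrMr.
  by field; rewrite !gt_eqF //; lra.
have squeeze (u : nat -> R) : (\forall n \near \oo, l n <= u n <= m n) ->
    u n / h n @[n --> \oo] --> (1 : R).
  move=> lum; apply: squeeze_cvgr lh mh.
  move: lum near_pos; apply: filterS2 => n /andP[lu um] [n2 t1 _ _ _].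
  have nR := pos_of_ge n n2.
  have hn : 0 < h n by rewrite divr_gt0 //; lra.
  by rewrite !ler_pM2r ?invr_gt0 // lu um.
have h_neq0 : \forall n \near \oo, h n != 0.
  apply: filterS near_pos => n [n2 t1 _ _ _].
  have nR := pos_of_ge n n2.
  by rewrite gt_eqF // divr_gt0 //; lra.
have beta_h : (beta R n - 1) / h n @[n --> \oo] --> (1 : R).
  apply: squeeze; apply: filterS near_pos => n [n2 t1 lt1 _ h1].
  move: n2; rewrite geq_max => /andP[_ n1].
  rewrite !lerD2r beta_ge_lower_base ?beta_le_upper_base // ?(ltnW n1) //.
  by rewrite -/(t n); lra.
have star_h : (beta_star R M n - 1) / h n @[n --> \oo] --> (1 : R).
  apply: squeeze; apply: filterS near_pos => n [n2 t1 lt1 Mh h1].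
  move: n2; rewrite geq_max => /andP[Mn n1].
  by rewrite !lerD2r; apply: beta_star_bounds => //; rewrite -/(t n); lra.
split; first exact: (asymp_equiv_of_ratio h_neq0).
exact: star_h.
Unshelve. all: by end_near.
Qed.
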